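(* For every integer $c\ge2$, the integrality gap of the LP relaxation below for MSSC on $c$-uniform hypergraphs is at least $\left(\frac{2c}{c+1}\right)^2$: that is, for every $\varepsilon>0$ there is a $c$-uniform hypergraph $H$ whose optimal MSSC value is at least $\left(\left(\frac{2c}{c+1}\right)^2-\varepsilon\right)$ times the optimal value of the LP for $H$.
   Context: A hypergraph is $c$-uniform if each hyperedge contains exactly $c$ vertices. MSSC on $H=(V,E)$: find a bijection $\sigma:V\to[n]$, $n=|V|$, minimizing $\sum_{e\in E}\min_{v\in e}\sigma(v)$. LP: variables $x_{v,t}\ge0$ ($v\in V$, $t\in[n]$), $u_{e,t}\ge0$ ($e\in E$, $t\in[n]$); minimize $\sum_{t,e}t\,u_{e,t}$ subject to $\sum_{v\in e}x_{v,t}-u_{e,t}\ge0$ for all $t,e$; $\sum_t u_{e,t}=1$ for all $e$; $\sum_v x_{v,t}=1$ for all $t$. *)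

(* Defs.v *)
From HB Require Import structures.
From mathcomp Require Import all_boot all_order all_algebra all_fingroup.
From mathcomp Require Import reals.
Set Implicit Arguments. Unset Strict Implicit. Unset Printing Implicit Defensive.
Import Order.TTheory GRing.Theory Num.Theory.

Definition uniform (n c : nat) (E : {set {set 'I_n}}) : Prop :=
  forall e, e \in E -> #|e| = c.

(* A bijection sigma : V -> [n] is a permutation s of 'I_n; vertex v gets
   position (s v).+1 in {1,...,n}. *)
Definition mssc_cost (n : nat) (E : {set {set 'I_n}}) (s : {perm 'I_n}) : nat :=
  \sum_(e in E) \big[minn/n]_(v in e) (s v).+1.

Definition mssc_opt (n : nat) (E : {set {set 'I_n}}) : nat :=
  \big[minn/mssc_cost E 1%g]_(s : {perm 'I_n}) mssc_cost E s.

Local Open Scope ring_scope.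

(* LP variables: x v t (v in V, t in [n]) and u e t (e in E, t in [n]);
   index t : 'I_n stands for the time t.+1 in {1,...,n}. *)
Definition lp_feasible (R : realFieldType) (n : nat) (E : {set {set 'I_n}})
    (x : 'I_n -> 'I_n -> R) (u : {set 'I_n} -> 'I_n -> R) : Prop :=
  [/\ (forall v t, 0 <= x v t),
      (forall e t, e \in E -> 0 <= u e t),
      (forall e t, e \in E -> 0 <= \sum_(v in e) x v t - u e t),
      (forall e, e \in E -> \sum_(t < n) u e t = 1) &
      (forall t, \sum_(v < n) x v t = 1)].

Definition lp_obj (R : realFieldType) (n : nat) (E : {set {set 'I_n}})
    (u : {set 'I_n} -> 'I_n -> R) : R :=
  \sum_(t < n) \sum_(e in E) (t.+1)%:R * u e t.

(* Main.v *)
(** A disjoint union of cliques (complete c-uniform hypergraphs) is solved by the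
    LP one clique after the other, in decreasing size, spreading the unit mass of
    each time step uniformly over the current clique: this finishes a clique on m
    vertices in m/c steps. An integral order can do no better than always
    truncating the largest remaining cliques. Take cliques on c j^2 vertices for
    1 <= j <= L, the number of cliques of level at least j being proportional to
    j^-(c+1). Then every level contributes about 1/j to both costs, with constants
    4 c^2 (integral) and (c+1)^2 (LP), so that boundary effects are negligible
    against the harmonic sum as L grows. *)

Require Import Defs.
From HB Require Import structures.
From mathcomp Require Import all_boot all_order all_algebra all_fingroup.
From mathcomp Require Import reals zify ring lra.
Set Implicit Arguments.
Unset Strict Implicit.
Unset Printing Implicit Defensive.
Import Order.TTheory GRing.Theory Num.Theory.

(** * Disjoint unions of complete uniform hypergraphs *)

Definition fiber (n : nat) (I : finType) (cl : 'I_n -> I) (i : I) :=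
  [set v | cl v == i].

Definition cliques (n : nat) (I : finType) (cl : 'I_n -> I) (c : nat)
  : {set {set 'I_n}} :=
  \bigcup_i [set e : {set 'I_n} | (e \subset fiber cl i) && (#|e| == c)].

Lemma coloring_with_fiber_sizes (I : finType) (m : I -> nat) :
  exists (n : nat) (cl : 'I_n -> I), forall i, #|fiber cl i| = m i.
Proof.
pose V : finType := {i : I & 'I_(m i)}.
exists #|V|, (fun v => tag (enum_val v : V)) => i.
have -> : fiber (fun v => tag (enum_val v : V)) i =
    enum_rank @: [set p : V | tag p == i].
  apply/setP => v; rewrite inE; apply/idP/imsetP => [ti | [p]].
    by exists (enum_val v); rewrite ?inE // enum_valK.
  by rewrite inE => ti ->; rewrite enum_rankK.
rewrite (card_imset _ enum_rank_inj) -sum1dep_card.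
under eq_bigl => p do rewrite -[tag p == i]andbT.
by rewrite -(sig_big_dep (pred1 i) (fun _ => xpredT) (fun _ _ => 1))
  big_pred1_eq sum1_card card_ord.
Qed.

(** For positive [c] an edge has a vertex, whose colour determines the clique; an empty edge would
    lie in every fiber. *)
Lemma big_cliques (R : Type) (idx : R) (op : Monoid.com_law idx)
    (n : nat) (I : finType) (cl : 'I_n -> I) (c : nat)
    (F : {set 'I_n} -> R) : 0 < c ->
  \big[op/idx]_(e in cliques cl c) F e =
  \big[op/idx]_i \big[op/idx]_(e : {set 'I_n} |
      (e \subset fiber cl i) && (#|e| == c)) F e.
Proof.
move=> c0; rewrite partition_disjoint_bigcup => [|i j ij].
  by apply: eq_bigr => i _; apply: eq_bigl => e; rewrite inE.
rewrite -setI_eq0; apply: contraNT ij => /set0Pn[e].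
rewrite !inE => /andP[/andP[ei /eqP ec] /andP[ej _]].
have /card_gt0P[v ve] : 0 < #|e| by rewrite ec.
move/subsetP: ei => /(_ _ ve); rewrite inE => /eqP <-.
by move/subsetP: ej => /(_ _ ve); rewrite inE.
Qed.

Lemma cliques_uniform (n : nat) (I : finType) (cl : 'I_n -> I) (c : nat) :
  uniform c (cliques cl c).
Proof. by move=> e /bigcupP[i _]; rewrite inE => /andP[_ /eqP]. Qed.

Lemma cliques_neq0 (n : nat) (I : finType) (cl : 'I_n -> I) (c : nat) (i : I) :
  c <= #|fiber cl i| -> cliques cl c != set0.
Proof.
rewrite -bin_gt0 -cards_draws => /card_gt0P[e ei].
by apply/set0Pn; exists e; apply/bigcupP; exists i.
Qed.

Lemma sum_card_fiber (n : nat) (I : finType) (cl : 'I_n -> I) (A : {set 'I_n}) :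
  \sum_i #|fiber cl i :&: A| = #|A|.
Proof.
rewrite -sum1_card (partition_big cl predT) //=.
apply: eq_bigr => i _; rewrite -sum1_card.
by apply: eq_bigl => v; rewrite !inE andbC.
Qed.

Lemma card_cliques_in (n : nat) (I : finType) (cl : 'I_n -> I) (c : nat)
    (A : {set 'I_n}) : 0 < c ->
  \sum_(e in cliques cl c) (e \subset A) = \sum_i 'C(#|fiber cl i :&: A|, c).
Proof.
move=> c0; rewrite big_cliques //; apply: eq_bigr => i _.
rewrite -cards_draws -sum1dep_card [RHS]big_mkcond [LHS]big_mkcond.
apply: eq_bigr => e _; rewrite subsetI.
by case: (e \subset A); case: (e \subset _); case: (_ == _).
Qed.

(** * Convexity of binomials and the lower bound on every integral order *)

(** By Pascal's rule the increment of ['C(_, c.+1)] at [b] is ['C(b, c)], which grows with [b]. Here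
    the [d] increments are compared with the first one, in the next lemma with the last one. *)
Lemma bin_tangent_ge (c a d : nat) :
  'C(a, c.+1) + d * 'C(a, c) <= 'C(a + d, c.+1).
Proof.
elim: d => [|d IH]; first by rewrite mul0n !addn0.
rewrite addnS binS mulSn; have := leq_bin2l c (leq_addr d a).
move: IH; rewrite /=; lia.
Qed.

Lemma bin_tangent_le (c a d : nat) :
  'C(a + d, c.+1) <= 'C(a, c.+1) + d * 'C((a + d).-1, c).
Proof.
elim: d => [|d IH]; first by rewrite mul0n !addn0.
rewrite addnS binS mulSn /=.
have : 'C((a + d).-1, c) <= 'C(a + d, c) by rewrite leq_bin2l ?leq_pred.
nia.
Qed.

(* The slope of ['C(_, c.+1)] just below [a] separates the slopes on both sides
   of [minn m a], so truncating every clique at a common size [a] minimises the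
   number of remaining edges for a given number of remaining vertices. *)
Lemma sum_bin_minn_le (I : finType) (m r : I -> nat) (c a : nat) :
  0 < a -> (forall i, r i <= m i) ->
  \sum_i minn (m i) a <= \sum_i r i ->
  \sum_i 'C(minn (m i) a, c.+1) <= \sum_i 'C(r i, c.+1).
Proof.
move=> a0 rm le_r.
have key i : 'C(minn (m i) a, c.+1) + 'C(a.-1, c) * r i <=
    'C(r i, c.+1) + 'C(a.-1, c) * minn (m i) a.
  have [lt_r | le_ri] := ltnP (minn (m i) a) (r i).
    have mua : minn (m i) a = a by have := rm i; lia.
    have := bin_tangent_ge c a (r i - a).
    rewrite mua; have -> : a + (r i - a) = r i by lia.
    have : 'C(a.-1, c) <= 'C(a, c) by rewrite leq_bin2l ?leq_pred.
    nia.
  have := bin_tangent_le c (r i) (minn (m i) a - r i).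
  have -> : r i + (minn (m i) a - r i) = minn (m i) a by lia.
  have : 'C((minn (m i) a).-1, c) <= 'C(a.-1, c) by rewrite leq_bin2l //; lia.
  nia.
have : \sum_i ('C(minn (m i) a, c.+1) + 'C(a.-1, c) * r i) <=
    \sum_i ('C(r i, c.+1) + 'C(a.-1, c) * minn (m i) a).
  by apply: leq_sum => i _.
rewrite !big_split /= -!big_distrr /=.
have := leq_mul (leqnn 'C(a.-1, c)) le_r; lia.
Qed.

Lemma sum_nat_lt (n T : nat) : T <= n -> \sum_(t < n) (t < T) = T.
Proof.
move=> Tn; rewrite -[RHS](minn_idPr Tn); elim: n {Tn} => [|n IH].
  by rewrite big_ord0 min0n.
by rewrite big_ord_recr /= IH; lia.
Qed.

Lemma leq_bigmin (J : finType) (P : pred J) (F : J -> nat) (x0 K : nat) :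
  K <= x0 -> (forall j, P j -> K <= F j) ->
  K <= \big[minn/x0]_(j | P j) F j.
Proof.
move=> K0 KF; elim/big_ind: _ => // x y Kx Ky.
by rewrite leq_min Kx.
Qed.

(** Layer-cake count: an edge first hit at position [p] is still untouched at the times [t < p], so
    it contributes at most [p]. *)
Lemma mssc_cost_ge_layers (n : nat) (E : {set {set 'I_n}}) (s : {perm 'I_n}) :
  \sum_(t < n) \sum_(e in E) (e \subset [set v | t <= s v]) <= mssc_cost E s.
Proof.
rewrite exchange_big; apply: leq_sum => e _; apply: leq_bigmin => [|v ve].
  (* The default value [n] of the minimum is respected too, as there are only [n] times. *)
  rewrite -[X in _ <= X]card_ord -sum1_card; apply: leq_sum => t _.
  exact: leq_b1.
rewrite -[X in _ <= X](sum_nat_lt (ltn_ord (s v))); apply: leq_sum => t _.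
by case: subsetP => // /(_ _ ve); rewrite inE ltnS => ->.
Qed.

Lemma card_perm_ge (n t : nat) (s : {perm 'I_n}) : t <= n ->
  #|[set v | t <= s v]| = n - t.
Proof.
move=> tn; have -> : [set v | t <= s v] = s @^-1: ~: [set w : 'I_n | w < t].
  by apply/setP => v; rewrite !inE -leqNgt.
rewrite card_preimset; last exact: perm_inj.
rewrite cardsCs setCK card_ord -sum1dep_card big_mkcond /=.
by rewrite -[in RHS](sum_nat_lt tn); congr (_ - _); apply: eq_bigr => w _; case: ltnP.
Qed.

(* [T a] is the time at which the greedy order has cut all cliques down to size
   at most [a], and [R a] the number of edges that remain at that time. *)
Lemma mssc_cost_cliques_ge (n : nat) (I : finType) (cl : 'I_n -> I) (c L : nat)
    (a : nat -> nat) (s : {perm 'I_n}) :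
  let m i := #|fiber cl i| in
  let T x := \sum_i (m i - x) in
  let R x := \sum_i 'C(minn (m i) x, c.+1) in
  a 0 = 0 -> (forall l, a l < a l.+1) ->
  \sum_(l < L) T (a l.+1) * (R (a l.+1) - R (a l)) <=
    mssc_cost (cliques cl c.+1) s.
Proof.
move=> m T R a0 a_lt; apply: leq_trans (mssc_cost_ge_layers _ s).
have sum_m : \sum_i m i = n.
  rewrite -[RHS]card_ord -cardsT -(sum_card_fiber cl).
  by apply: eq_bigr => i _; rewrite setIT.
have T_le x : T x <= n by rewrite -sum_m; apply: leq_sum => i _; exact: leq_subr.
have R_mono l : R (a l) <= R (a l.+1).
  by apply: leq_sum => i _; apply: leq_bin2l; have := a_lt l; lia.
have R0 : R (a 0) = 0.
  by rewrite a0; apply: big1 => i _; rewrite minn0 bin0n.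
have swap : \sum_(l < L) T (a l.+1) * (R (a l.+1) - R (a l)) =
    \sum_(t < n) \sum_(l < L) (t < T (a l.+1)) * (R (a l.+1) - R (a l)).
  rewrite exchange_big; apply: eq_bigr => l _.
  by rewrite -big_distrl /= sum_nat_lt.
rewrite swap; apply: leq_sum => t _; rewrite card_cliques_in //.
set A := [set _ | _]; set rem := \sum_i _.
(* At time [t] there are [n - t] vertices left, more than the [n - T (a l.+1)] left by the
   truncation at [a l.+1]. *)
have rem_ge l : t < T (a l.+1) -> R (a l.+1) <= rem.
  move=> tT; apply: sum_bin_minn_le => [|i|].
  - by have := a_lt l; lia.
  - by rewrite subset_leq_card // subsetIl.
  rewrite sum_card_fiber card_perm_ge; last exact: ltnW.
  have : \sum_i minn (m i) (a l.+1) + T (a l.+1) = n.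
    by rewrite -big_split /= -sum_m; apply: eq_bigr => i _; lia.
  lia.
(* Levels are discarded from the top until one satisfies [t < T (a l.+1)]; from there down the
   differences telescope to at most [R (a l.+1)]. *)
elim: L {swap} => [|L IH]; first by rewrite big_ord0.
rewrite big_ord_recr /=; case: ltnP => [tT|_]; last by rewrite mul0n addn0.
rewrite mul1n; apply: leq_trans (rem_ge _ tT).
rewrite -[X in _ <= X](subnK (R_mono L)) addnC leq_add2l.
elim: L {IH tT} => [|L IH]; first by rewrite big_ord0.
rewrite big_ord_recr /= -[X in _ <= X](subnK (R_mono L)) addnC leq_add //.
by case: (_ < _); rewrite ?mul1n.
Qed.

(** * The fractional schedule and the upper bound on the LP *)

(** Entry [t] of [s] is the clique served at time [t]. Sorting by decreasing [k] leaves only entries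
    [j] with [k i <= k j] up to any occurrence of [i]. *)
Lemma decreasing_schedule (I : finType) (k : I -> nat) :
  exists s : seq I,
    [/\ size s = \sum_i k i, forall i, count_mem i s = k i &
        forall i t, onth s t = Some i -> t < \sum_(j | k i <= k j) k j].
Proof.
pose s0 := flatten [seq nseq (k i) i | i <- enum I].
pose leT i j := k j <= k i.
have count_s0 (p : pred I) : count p s0 = \sum_(i | p i) k i.
  rewrite count_flatten sumnE -map_comp big_map big_enum /= [RHS]big_mkcond.
  by apply: eq_bigr => i _; rewrite count_nseq; case: (p i); rewrite ?mul1n.
exists (sort leT s0); split=> [|i|i t].
- by rewrite size_sort -(count_predT s0) count_s0.
- by rewrite count_sort count_s0 big_pred1_eq.
set s := sort leT s0 => sti.
have ts : t < size s by rewrite -onthTE sti.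
have nthi : nth i s t = i by exact: onth_nth.
have s_sorted : sorted leT s by apply: sort_sorted => x y; apply: leq_total.
have leT_trans : transitive leT by move=> x y z; rewrite /leT => yx /leq_trans; apply.
rewrite -(count_s0 (fun j => k i <= k j)) -(count_sort leT) -/s.
rewrite -(cat_take_drop t.+1 s) count_cat.
apply: leq_trans (leq_addr _ _).
suff: all (fun j => k i <= k j) (take t.+1 s).
  by rewrite all_count size_takel // => /eqP ->.
apply/(all_nthP i) => j.
rewrite size_takel // => jt; rewrite nth_take // -{1}nthi.
by apply: (sorted_leq_nth leT_trans (fun x => leqnn _)) => //; rewrite ?inE; lia.
Qed.

Local Open Scope ring_scope.

Lemma sum_onth (R : realFieldType) (T : Type) (s : seq T) (n : nat)
    (f : T -> R) : (size s <= n)%N ->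
  \sum_(t < n) oapp f 0 (onth s t) = \sum_(i <- s) f i.
Proof.
elim: s n => [|a s IH] n.
  by rewrite big_nil => _; apply: big1 => t _; rewrite onth0n.
case: n => // n; rewrite /= ltnS => sn.
by rewrite big_cons -(IH n sn) big_ord_recl.
Qed.

Lemma lp_cliques_le (R : realFieldType) (n : nat) (I : finType)
    (cl : 'I_n -> I) (k : I -> nat) (c : nat) :
  (0 < c)%N -> (forall i, 0 < k i)%N ->
  (forall i, #|fiber cl i| = c * k i)%N ->
  exists (x : 'I_n -> 'I_n -> R) (u : {set 'I_n} -> 'I_n -> R),
    lp_feasible (cliques cl c) x u /\
    lp_obj (cliques cl c) u <=
      (\sum_i 'C(c * k i, c) * \sum_(j | k i <= k j) k j)%:R.
Proof.
move=> c0 k0 card_fib; have [s [size_s count_s s_lt]] := decreasing_schedule k.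
pose w v i : R := (cl v == i)%:R / (c * k i)%:R.
pose y v (t : 'I_n) := oapp (w v) 0 (onth s t).
(* [y] is zero after the end of the schedule, whereas [x] must have total mass 1 at every time and
   is filled up uniformly there. The edge variables use only [y], so the filling costs nothing. *)
pose x v (t : 'I_n) := oapp (w v) n%:R^-1 (onth s t).
pose u (e : {set 'I_n}) t := \sum_(v in e) y v t.
have ck0 i : (c * k i)%:R != 0 :> R by rewrite pnatr_eq0 -lt0n muln_gt0 c0 k0.
have w_ge0 v i : 0 <= w v i by rewrite divr_ge0.
have y_ge0 v t : 0 <= y v t by rewrite /y; case: onth => //= i; exact: w_ge0.
have yx v t : y v t <= x v t.
  by rewrite /y /x; case: onth => //=; rewrite invr_ge0.
have size_n : (size s <= n)%N.
  rewrite size_s -[X in (_ <= X)%N]card_ord -cardsT -(sum_card_fiber cl).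
  by apply: leq_sum => i _; rewrite setIT card_fib leq_pmull.
have sum_y v : \sum_t y v t = c%:R^-1.
  rewrite /y sum_onth // /w.
  rewrite (eq_bigr (fun i => (cl v == i)%:R / (c * k (cl v))%:R)) => [|i _];
    last by case: eqP => [<-|]; rewrite ?mul0r.
  rewrite -mulr_suml -natr_sum.
  have -> : (\sum_(i <- s) (cl v == i) = k (cl v))%N.
    rewrite -count_s -sum1_count [RHS]big_mkcond /=.
    by apply: eq_bigr => i _; rewrite (eq_sym i); case: eqP.
  rewrite natrM invfM mulrCA divff ?mulr1 // pnatr_eq0 -lt0n; exact: k0.
have u_sum e : e \in cliques cl c -> \sum_t u e t = 1.
  move=> eE; rewrite exchange_big /= (eq_bigr _ (fun v _ => sum_y v)).
  rewrite sumr_const (cliques_uniform eE) -(mulr_natl c%:R^-1) divff //.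
  by rewrite pnatr_eq0 -lt0n.
exists x, u; split; first split => //.
- by move=> v t; apply: le_trans (yx v t).
- by move=> e t _; apply: sumr_ge0.
- by move=> e t _; rewrite subr_ge0; apply: ler_sum => v _; exact: yx.
- move=> t; rewrite /x; case: onth => [i|] /=; last first.
    by rewrite sumr_const card_ord -(mulr_natl n%:R^-1) divff // pnatr_eq0; case: (n) t => [[]|].
  rewrite -mulr_suml -natr_sum -[RHS](divff (ck0 i)) -card_fib; congr (_%:R / _).
  rewrite -sum1dep_card [RHS]big_mkcond /=; apply: eq_bigr => v _.
  by case: eqP.
pose W i := (\sum_(j | k i <= k j) k j)%N.
(* Vertex [v] receives its total mass 1/c only while its own clique is served, which is over by time
   [W (cl v)]. *)
have weight_y v : \sum_(t < n) t.+1%:R * y v t <= (W (cl v))%:R / c%:R.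
  rewrite -(sum_y v) mulr_sumr; apply: ler_sum => t _; rewrite /y.
  case sti : (onth s t) => [i|] /=; last by rewrite !mulr0.
  rewrite /w; case: eqP => [->|_]; last by rewrite mul0r !mulr0.
  by rewrite ler_wpM2r ?divr_ge0 // ler_nat; exact: s_lt.
rewrite /lp_obj exchange_big /=.
rewrite big_cliques // natr_sum; apply: ler_sum => i _.
rewrite natrM -{1}(card_fib i) -cards_draws -sum1dep_card natr_sum mulr_suml.
apply: ler_sum => e /andP[/subsetP eF /eqP ec]; rewrite mul1r.
rewrite /u; under eq_bigr => t _ do rewrite mulr_sumr.
rewrite exchange_big /=; apply: (@le_trans _ _ (\sum_(v in e) (W i)%:R / c%:R)).
  apply: ler_sum => v /eF; rewrite inE => /eqP <-; exact: weight_y.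
by rewrite sumr_const ec -(mulr_natr (_ / _)) divfK // pnatr_eq0 -lt0n.
Qed.

(** * Both bounds for cliques of quadratically growing sizes *)

(** The instance has [q j] cliques on [c.+1 * j.+1 ^ 2] vertices for each level [j < L], and the
    truncation sizes are these clique sizes. Truncating at level [l] affects only higher levels,
    which is why the sums start at [l]. *)
Lemma clique_levels (R : realFieldType) (c L : nat) (q : nat -> nat) :
  (0 < L)%N -> (0 < q L.-1)%N ->
  exists (n : nat) (E : {set {set 'I_n}}),
    [/\ E != set0, uniform c.+1 E,
      exists (x : 'I_n -> 'I_n -> R) (u : {set 'I_n} -> 'I_n -> R),
        lp_feasible E x u /\
        lp_obj E u <= (\sum_(0 <= j < L) q j * ('C(c.+1 * j.+1 ^ 2, c.+1) *
          \sum_(j <= i < L) q i * i.+1 ^ 2))%:R &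
      (\sum_(0 <= l < L)
         (\sum_(l <= j < L) q j * (c.+1 * (j.+1 ^ 2 - l.+1 ^ 2))) *
         ((\sum_(l <= j < L) q j) *
           ('C(c.+1 * l.+1 ^ 2, c.+1) - 'C(c.+1 * l ^ 2, c.+1)))
       <= mssc_opt E)%N].
Proof.
move=> L0 qL; pose I : finType := {j : 'I_L & 'I_(q j)}.
pose k (i : I) := ((tag i).+1 ^ 2)%N.
have sum_I (F : nat -> nat) :
    (\sum_(i : I) F (tag i) = \sum_(0 <= j < L) q j * F j)%N.
  rewrite big_mkord.
  rewrite -(sig_big_dep xpredT (fun _ => xpredT) (fun (j : 'I_L) _ => F j)).
  by apply: eq_bigr => j _; rewrite sum_nat_const card_ord.
have sum_from l (F : nat -> nat) :
    (\sum_(0 <= j < L) (if l <= j then F j else 0) = \sum_(l <= j < L) F j)%N.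
  by rewrite -big_mkcond big_mkord big_geq_mkord.
have k0 i : (0 < k i)%N by rewrite expn_gt0.
have [n [cl card_fib]] := coloring_with_fiber_sizes (fun i : I => c.+1 * k i)%N.
exists n, (cliques cl c.+1); split.
- have ltL : (L.-1 < L)%N by rewrite prednK.
  apply: (@cliques_neq0 _ _ _ _ (Tagged _ (Ordinal qL : 'I_(q (Ordinal ltL))))).
  by rewrite card_fib leq_pmulr.
- exact: cliques_uniform.
- have [x [u [feas obj]]] := @lp_cliques_le R n I cl k c.+1 isT k0 card_fib.
  exists x, u; split=> //; apply: le_trans obj _; rewrite ler_nat.
  rewrite -(sum_I (fun j => 'C(c.+1 * j.+1 ^ 2, c.+1) *
          \sum_(j <= i < L) q i * i.+1 ^ 2)%N).
  apply: leq_sum => i _; rewrite leq_mul //.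
  rewrite big_mkcond -sum_from /=.
  rewrite (sum_I (fun j => if k i <= j.+1 ^ 2 then j.+1 ^ 2 else 0)%N).
  apply: leq_sum => j _; rewrite /k leq_exp2r // ltnS.
  by case: ifP; rewrite ?muln0.
suff opt s : (\sum_(0 <= l < L)
         (\sum_(l <= j < L) q j * (c.+1 * (j.+1 ^ 2 - l.+1 ^ 2))) *
         ((\sum_(l <= j < L) q j) *
           ('C(c.+1 * l.+1 ^ 2, c.+1) - 'C(c.+1 * l ^ 2, c.+1)))
       <= mssc_cost (cliques cl c.+1) s)%N by apply: leq_bigmin.
have lt_a l : (c.+1 * l ^ 2 < c.+1 * l.+1 ^ 2)%N by rewrite ltn_pmul2l ?ltn_exp2r.
have := @mssc_cost_cliques_ge n I cl c L (fun l => c.+1 * l ^ 2)%N s (muln0 _) lt_a.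
apply: leq_trans.
rewrite big_mkord; apply: leq_sum => l _; apply: leq_mul.
  under [leqRHS]eq_bigr => i _ do rewrite card_fib -mulnBr.
  rewrite (sum_I (fun j => c.+1 * (j.+1 ^ 2 - l.+1 ^ 2))%N) -sum_from.
  by apply: leq_sum => j _; case: ifP.
(* A clique of level at least [l] is truncated to exactly the two given sizes, so it accounts for
   the full difference [D]. *)
rewrite -sumnB => [|i _]; last first.
  by apply: leq_bin2l; rewrite leq_min geq_minl geq_min (ltnW (lt_a l)) orbT.
pose D := ('C(c.+1 * l.+1 ^ 2, c.+1) - 'C(c.+1 * l ^ 2, c.+1))%N.
rewrite -/D big_distrl /= -(sum_from l (fun j => q j * D)%N).
apply: (@leq_trans (\sum_(0 <= j < L) q j * (if l <= j then D else 0))%N).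
  by apply: leq_sum => j _; case: ifP; rewrite ?muln0.
rewrite -(sum_I (fun j => if l <= j then D else 0)%N).
apply: leq_sum => i _; case: ifP => // lj; rewrite card_fib /D.
have le_exp a b : (a <= b -> c.+1 * a ^ 2 <= c.+1 * b ^ 2)%N.
  by move=> ab; rewrite leq_mul2l leq_exp2r.
by rewrite !(minn_idPr _) // ?le_exp // ltnW.
Qed.

(** * Elementary estimates for powers, harmonic sums and binomials *)

(** Mean value bounds for powers, by induction from the two ways of splitting one factor off the
    difference. *)
Lemma subX_bounds (R : realFieldType) (a b : R) (k : nat) : 0 <= b <= a ->
  k.+1%:R * b ^+ k * (a - b) <= a ^+ k.+1 - b ^+ k.+1
    <= k.+1%:R * a ^+ k * (a - b).
Proof.
move=> /andP[b0 ab]; elim: k => [|k /andP[IH1 IH2]].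
  by rewrite !expr0 !expr1 !mulr1 !mul1r !lexx.
have a0 := le_trans b0 ab.
have bk : 0 <= b ^+ k.+1 by rewrite exprn_ge0.
have bak : b ^+ k.+1 <= a ^+ k.+1 by rewrite lerXn2r.
have d0 : 0 <= a - b by rewrite subr_ge0.
have split_a : a ^+ k.+2 - b ^+ k.+2 =
    a * (a ^+ k.+1 - b ^+ k.+1) + b ^+ k.+1 * (a - b) by rewrite !exprS; ring.
have split_b : a ^+ k.+2 - b ^+ k.+2 =
    b * (a ^+ k.+1 - b ^+ k.+1) + a ^+ k.+1 * (a - b) by rewrite !exprS; ring.
have bakd : b ^+ k.+1 * (a - b) <= a ^+ k.+1 * (a - b) by rewrite ler_wpM2r.
apply/andP; split.
  rewrite split_b; apply: le_trans (lerD (ler_wpM2l b0 IH1) bakd).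
  by rewrite [k.+2%:R]mulrSr (exprS b k) le_eqVlt; apply/orP; left; apply/eqP; ring.
rewrite split_a; apply: le_trans (lerD (ler_wpM2l a0 IH2) bakd) _.
by rewrite [k.+2%:R]mulrSr (exprS a k) le_eqVlt; apply/orP; left; apply/eqP; ring.
Qed.

(** [y j - y j.+1] equals [y j * y j.+1], which lies between the squares of the two factors. The
    bounds serve to compare power sums with telescoping sums. *)
Lemma invX_step (R : realFieldType) (j k : nat) :
  let y i : R := i.+1%:R^-1 in
  k.+1%:R * y j.+1 ^+ k.+2 <= y j ^+ k.+1 - y j.+1 ^+ k.+1 /\
  y j ^+ k.+1 - y j.+1 ^+ k.+1 <= k.+1%:R * y j ^+ k.+2.
Proof.
move=> y.
have y_gt0 i : 0 < y i by rewrite invr_gt0 ltr0n.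
have yy : y j - y j.+1 = y j * y j.+1.
  have : 0 < j.+1%:R :> R by rewrite ltr0n.
  rewrite /y -[j.+2%:R]natr1; move: j.+1%:R => a a0; field.
  by rewrite !gt_eqF ?addr_gt0.
have le_y : y j.+1 <= y j by rewrite -subr_ge0 yy mulr_ge0 ?ltW.
have /andP[lo hi] := @subX_bounds _ (y j) (y j.+1) k
  (introT andP (conj (ltW (y_gt0 _)) le_y)).
have yj0 := ltW (y_gt0 j); have yj1 := ltW (y_gt0 j.+1).
split; [apply: le_trans lo | apply: le_trans hi _]; rewrite yy.
  rewrite !exprSr -!mulrA ler_wpM2l // ler_wpM2l ?exprn_ge0 //.
  by rewrite ler_wpM2r.
rewrite !exprSr -!mulrA ler_wpM2l // ler_wpM2l ?exprn_ge0 //.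
by rewrite ler_wpM2l.
Qed.

(** Every dyadic block of the harmonic sum contributes at least 1/2. *)
Lemma harmonic_unbounded (R : archiRealFieldType) (x : R) :
  exists M, x <= \sum_(0 <= j < M.+1) j.+1%:R^-1.
Proof.
have H p : p%:R / 2 <= \sum_(0 <= j < 2 ^ p) j.+1%:R^-1 :> R.
  elim: p => [|p IH]; first by rewrite mul0r sumr_ge0 // => j _; rewrite invr_ge0.
  rewrite (@big_cat_nat _ _ _ (2 ^ p)) ?leq_exp2l //=.
  rewrite -natr1 mulrDl lerD // mul1r.
  have -> : 2^-1 = \sum_(2 ^ p <= j < 2 ^ p.+1) (2 ^ p.+1)%:R^-1 :> R.
    rewrite sumr_const_nat expnS natrM -(mulr_natr _^-1); set N := (2 ^ p)%N.
    have -> : (2 * N - N = N)%N by lia.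
    by rewrite invfM mulfVK // pnatr_eq0 -lt0n expn_gt0.
  apply: ler_sum_nat => j /andP[_ jp].
  by rewrite lef_pV2 ?posrE ?ltr0n ?expn_gt0 // ler_nat.
have [p xp] : exists p, x * 2 <= p%:R.
  by exists (Num.bound `|x * 2|); rewrite (le_trans (ler_norm _)) // ltW ?archi_boundP.
exists (2 ^ p).-1; rewrite prednK ?expn_gt0 //; apply: le_trans (H p).
by rewrite ler_pdivlMr.
Qed.

Lemma bin_le_expn (n k : nat) : ('C(n, k) * k`! <= n ^ k)%N.
Proof.
rewrite bin_ffact; elim: k => [|k IH]; first by rewrite ffactn0 expn0.
by rewrite ffactnSr expnSr leq_mul // leq_subr.
Qed.

Lemma expn_le_bin (n k : nat) : ((n - k) ^ k <= 'C(n, k) * k`!)%N.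
Proof.
rewrite bin_ffact; have H i : (i <= k -> (n - k) ^ i <= n ^_ i)%N.
  elim: i => [|i IH] ik; first by rewrite ffactn0 expn0.
  rewrite ffactnSr expnSr; apply: leq_mul; [exact/IH/ltnW|].
  exact/leq_sub2l/ltnW.
exact: H.
Qed.

(** Relative errors add up, since (1-x)(1-y) exceeds 1-x-y by xy. If [x] or [y] is above 1, the left
    side is nonpositive. *)
Lemma mulr_one_sub_ge (R : realFieldType) (a b p q x y : R) :
  0 <= a -> 0 <= b -> 0 <= p -> 0 <= q -> 0 <= x -> 0 <= y ->
  p * (1 - x) <= a -> q * (1 - y) <= b -> p * q * (1 - x - y) <= a * b.
Proof.
move=> a0 b0 p0 q0 x0 y0 pa qb.
have ab0 : 0 <= a * b by rewrite mulr_ge0.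
have pq0 : 0 <= p * q by rewrite mulr_ge0.
have [x1|x1] := ltP 1 x.
  by apply: le_trans ab0; rewrite mulr_ge0_le0 //; lra.
have [y1|y1] := ltP 1 y.
  by apply: le_trans ab0; rewrite mulr_ge0_le0 //; lra.
apply: (@le_trans _ _ ((p * (1 - x)) * (q * (1 - y)))).
  have -> : p * (1 - x) * (q * (1 - y)) = p * q * (1 - x - y + x * y) by ring.
  by rewrite ler_wpM2l // lerDl mulr_ge0.
by apply: ler_pM => //; apply: mulr_ge0 => //; lra.
Qed.

Lemma bernoulli_sub (R : realFieldType) (x : R) (k : nat) : 0 <= x <= 1 ->
  1 - k.+1%:R * x <= (1 - x) ^+ k.+1.
Proof.
move=> x01; have /andP[_] := @subX_bounds R 1 (1 - x) k ltac:(lra).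
by rewrite !expr1n mulr1; lra.
Qed.

(** With [c = d.+2], the constant is c^c/c!, the leading coefficient of the binomial in powers of
    [j.+1]. *)
Lemma bin_square_le (R : realFieldType) (d j : nat) :
  'C(d.+2 * j.+1 ^ 2, d.+2)%:R <=
    d.+2%:R ^+ d.+1 / d.+1`!%:R * j.+1%:R ^+ (2 * d.+2) :> R.
Proof.
have f0 : 0 < (d.+2)`!%:R :> R by rewrite ltr0n fact_gt0.
rewrite -(ler_pM2r f0) -natrM.
apply: (@le_trans _ _ ((d.+2 * j.+1 ^ 2) ^ d.+2)%:R).
  by rewrite ler_nat bin_le_expn.
rewrite (factS d.+1) natrM expnMn -expnM natrM !natrX exprSr le_eqVlt.
have : d.+1`!%:R != 0 :> R by rewrite pnatr_eq0 -lt0n fact_gt0.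
move: d.+2%:R d.+1`!%:R (d.+2%:R ^+ d.+1) (j.+1%:R ^+ _) => r f p q f_neq0.
by apply/orP; left; apply/eqP; field.
Qed.

(** With [c = d.+2], the main term is the derivative of kappa J^(2c). The tangent at [j] has the
    relative errors 1/(2J) from the step length and 2(c-1)/J from the slope, together at most
    2c/J. *)
Lemma bin_square_diff_ge (R : realFieldType) (d j : nat) :
  d.+2%:R ^+ d.+1 / d.+1`!%:R * (2 * d.+2%:R) * j.+1%:R ^+ (2 * d + 3)
    * (1 - 2 * d.+2%:R / j.+1%:R)
  <= ('C(d.+2 * j.+1 ^ 2, d.+2) - 'C(d.+2 * j ^ 2, d.+2))%:R :> R.
Proof.
set kappa := (_ / _); set J : R := j.+1%:R.
have J0 : 0 < J by rewrite ltr0n.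
have J_ge0 := ltW J0.
have kappa0 : 0 <= kappa by rewrite divr_ge0 ?exprn_ge0.
have c0 : 0 <= d.+2%:R :> R by [].
have [le_J|lt_J] := leP J (2 * d.+2%:R).
  apply: le_trans (ler0n _ _); rewrite mulr_ge0_le0 //.
    by rewrite (mulr_ge0 (mulr_ge0 kappa0 _)) ?exprn_ge0 // mulr_ge0.
  by rewrite subr_le0 ler_pdivlMr // mul1r.
have step : (d.+2 * (2 * j + 1) * 'C(d.+2 * j ^ 2, d.+1) <=
    'C(d.+2 * j.+1 ^ 2, d.+2) - 'C(d.+2 * j ^ 2, d.+2))%N.
  have := bin_tangent_ge d.+1 (d.+2 * j ^ 2) (d.+2 * (2 * j + 1)).
  have -> : (d.+2 * j ^ 2 + d.+2 * (2 * j + 1) = d.+2 * j.+1 ^ 2)%N.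
    by rewrite -mulnDr; congr (_ * _)%N; lia.
  lia.
rewrite -(ler_nat R) in step; apply: le_trans step.
have f0 : 0 < (d.+1)`!%:R :> R by rewrite ltr0n fact_gt0.
have j2 : (2 <= j)%N.
  have : (2 * d.+2)%:R < j.+1%:R :> R by rewrite natrM.
  by rewrite ltr_nat; lia.
have bin_ge : kappa * J ^+ (2 * d.+1) * (1 - d.+1%:R * (2 / J)) <=
    'C(d.+2 * j ^ 2, d.+1)%:R.
  rewrite -(ler_pM2r f0) -natrM.
  apply: (@le_trans _ _ ((d.+2 * j ^ 2 - d.+1) ^ d.+1)%:R); last first.
    by rewrite ler_nat expn_le_bin.
  apply: (@le_trans _ _ ((d.+2%:R * J ^+ 2 * (1 - 2 / J)) ^+ d.+1)).
    rewrite 2!exprMn -exprM /kappa.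
    rewrite (_ : _ * _ = d.+2%:R ^+ d.+1 * J ^+ (2 * d.+1) * (1 - d.+1%:R * (2 / J))).
      rewrite ler_wpM2l ?mulr_ge0 ?exprn_ge0 // ?(ltW J0) // bernoulli_sub //.
      rewrite divr_ge0 ?(ltW J0) //= ler_pdivrMr // mul1r ler_nat; lia.
    move: (d.+1)`!%:R f0 (d.+2%:R ^+ d.+1) (J ^+ _) (1 - _) => f f0 p A B.
    by field; rewrite gt_eqF.
  rewrite natrX lerXn2r ?nnegrE ?ler0n //.
    rewrite !mulr_ge0 ?exprn_ge0 ?(ltW J0) // subr_ge0 ler_pdivrMr // mul1r ler_nat; lia.
  (* The value is c(j^2 - 1), hence at most c j^2 - (c-1). *)
  have -> : d.+2%:R * J ^+ 2 * (1 - 2 / J) = (d.+2 * (j.+1 * j.-1))%:R.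
    have J_pred : j.-1%:R = J - 2.
      by rewrite /J -(natrB _ (_ : 2 <= j.+1)%N); [congr _%:R; lia | lia].
    rewrite !natrM J_pred -/J; move: d.+2%:R (J) J0 => p a a0.
    by field; rewrite gt_eqF.
  by rewrite ler_nat; nia.
rewrite natrM.
have lin : 2 * d.+2%:R * J * (1 - 2^-1 / J) <= (d.+2 * (2 * j + 1))%:R.
  rewrite natrM natrD natrM /J -[j.+1%:R]natr1; have := ler0n R j; move: j%:R => a a0.
  rewrite le_eqVlt; apply/orP; left; apply/eqP; field.
  by rewrite gt_eqF //; lra.
have Jinv_ge0 : 0 <= J^-1 by rewrite invr_ge0.
have p0 : 0 <= 2 * d.+2%:R * J by rewrite !mulr_ge0.
have q0 : 0 <= kappa * J ^+ (2 * d.+1) by rewrite (mulr_ge0 kappa0) ?exprn_ge0.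
have x0 : 0 <= 2^-1 / J by rewrite mulr_ge0 ?invr_ge0.
have y0 : 0 <= d.+1%:R * (2 / J) by rewrite mulr_ge0 ?divr_ge0.
apply: le_trans (mulr_one_sub_ge (ler0n _ _) (ler0n _ _) p0 q0 x0 y0 lin bin_ge).
have -> : kappa * (2 * d.+2%:R) * J ^+ (2 * d + 3) =
    2 * d.+2%:R * J * (kappa * J ^+ (2 * d.+1)).
  have -> : (2 * d + 3 = (2 * d.+1).+1)%N by rewrite mulnS add2n addn3.
  rewrite exprS.
  move: (kappa) d.+2%:R (J) (J ^+ _) => a b z A.
  by ring.
rewrite (ler_wpM2l (mulr_ge0 p0 q0)) //.
rewrite -[d.+2%:R]natr1; move: J^-1 d.+1%:R Jinv_ge0 => z p z0; lra.
Qed.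

(** * Summation by parts against the level weights *)

Lemma sum_abel (R : comPzRingType) (s g : nat -> R) (l n : nat) : (l <= n)%N ->
  \sum_(l <= j < n) (s j - s j.+1) * g j =
    s l * g l - s n * g n + \sum_(l <= j < n) s j.+1 * (g j.+1 - g j).
Proof.
move=> ln; apply/eqP; rewrite -subr_eq -sumrB -opprB; apply/eqP.
rewrite -(telescope_sumr (fun j => s j * g j) ln) -sumrN.
by apply: eq_bigr => j _; ring.
Qed.

(* From here on [c = d.+2], and the level [j] is counted from 0: it consists of
   the cliques on [c * j.+1 ^ 2] vertices. [weight R d M j] is the normalised
   number of cliques of level at least [j], when [M] is the highest level. *)
Definition weight (R : realFieldType) (d M j : nat) : R :=
  if (j <= M)%N then j.+1%:R^-1 ^+ d.+3 else 0.

(** As 2j+3 = (j+2)^2 - (j+1)^2, summation by parts identifies [c] times this number with the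
    normalised time needed to cut all cliques down to level [l]. *)
Definition tail (R : realFieldType) (d M l : nat) : R :=
  \sum_(l <= j < M.+1) weight R d M j.+1 * (2 * j + 3)%:R.

Lemma tail_le (R : realFieldType) (d M l : nat) : (l <= M)%N ->
  tail R d M l <= 2 / d.+1%:R * l.+1%:R^-1 ^+ d.+1.
Proof.
move=> lM; pose y i : R := i.+1%:R^-1.
have y0 i : 0 <= y i by rewrite invr_ge0.
rewrite /tail; apply: (@le_trans _ _
    (\sum_(l <= j < M.+1) - (2 / d.+1%:R * y j.+1 ^+ d.+1 - 2 / d.+1%:R * y j ^+ d.+1))).
  apply: ler_sum_nat => j /andP[_ jM].
  have [lo _] := @invX_step R j d; rewrite -!/(y _) in lo.
  apply: (@le_trans _ _ (2 * y j.+1 ^+ d.+2)); last first.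
    rewrite opprB -mulrBr -mulrA ler_pM2l // -ler_pdivrMl ?invr_gt0 //.
    by rewrite invrK.
  rewrite /weight; case: ifP => _; last by rewrite mul0r mulr_ge0 ?exprn_ge0.
  rewrite -/(y _) exprSr -mulrA [leRHS]mulrC ler_wpM2l ?exprn_ge0 //.
  rewrite mulrC /y ler_pdivrMr ?ltr0n //.
  rewrite natrD natrM -[j.+2%:R]natr1 -[j.+1%:R]natr1; lra.
rewrite sumrN (telescope_sumr (fun j => 2 / d.+1%:R * y j ^+ d.+1)); last by lia.
by rewrite opprB gerBl mulr_ge0 ?exprn_ge0 // divr_ge0.
Qed.

(** The first error term pays for shifting [l] by one and for the lower-order part of the summand,
    the second for stopping at [M]. *)
Lemma tail_ge (R : realFieldType) (d M l : nat) : (l <= M)%N ->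
  2 / d.+1%:R * l.+1%:R^-1 ^+ d.+1 *
    (1 - (d.+2%:R / l.+1%:R + l.+1%:R / M.+1%:R)) <= tail R d M l.
Proof.
move=> lM; pose y i : R := i.+1%:R^-1.
have y0 i : 0 <= y i by rewrite invr_ge0.
(* The summand is [2 * y j.+1 ^+ d.+2 - y j.+1 ^+ d.+3]; the two parts of [f] telescope against its
   two terms by [invX_step]. *)
pose f j : R := - (2 / d.+1%:R * y j.+1 ^+ d.+1) + y j ^+ d.+2 / d.+2%:R.
apply: (@le_trans _ _ (\sum_(l <= j < M) (f j.+1 - f j))); last first.
  rewrite /tail big_nat_recr //= {2}/weight ltnn mul0r addr0.
  apply: ler_sum_nat => j /andP[_ jM]; rewrite /weight jM -/(y _).
  have [lo hi] := @invX_step R j d.+1; rewrite -!/(y _) in lo hi.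
  have [lo' hi'] := @invX_step R j.+1 d; rewrite -!/(y _) in lo' hi'.
  have -> : y j.+1 ^+ d.+3 * (2 * j + 3)%:R = 2 * y j.+1 ^+ d.+2 - y j.+1 ^+ d.+3.
    have -> : (2 * j + 3)%:R = 2 / y j.+1 - 1 :> R.
      by rewrite /y invrK natrD natrM -[j.+2%:R]natr1 -[j.+1%:R]natr1; ring.
    have yn : y j.+1 != 0 by rewrite invr_neq0 // pnatr_eq0.
    by rewrite exprSr; move: (y j.+1) (y j.+1 ^+ _) yn => a b an; field.
  have p0 : 0 < d.+1%:R :> R by rewrite ltr0n.
  have q0 : 0 < d.+2%:R :> R by rewrite ltr0n.
  rewrite -(ler_pdivlMl _ _ q0) in lo; rewrite -(ler_pdivrMl _ _ p0) in hi'.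
  rewrite /f; move: lo hi' {p0 q0 lo' hi}.
  move: d.+1%:R^-1 d.+2%:R^-1 (y j ^+ d.+2) (y j.+1 ^+ d.+3) (y j.+1 ^+ d.+2).
  by move: (y j.+1 ^+ d.+1) (y j.+2 ^+ d.+1) => *; lra.
rewrite telescope_sumr // /f.
have [_ step] := @invX_step R l d; rewrite -!/(y _) in step.
have p0 : 0 < d.+1%:R :> R by rewrite ltr0n.
have yM_le : y M <= y l.
  by rewrite lef_pV2 ?posrE ?ltr0n // ler_nat.
have yM1_le : y M.+1 <= y M by rewrite lef_pV2 ?posrE ?ltr0n // ler_nat.
have top : y M.+1 ^+ d.+1 <= y l ^+ d.+1 * (l.+1%:R * y M).
  apply: (@le_trans _ _ (y l ^+ d * y M)).
    by rewrite exprSr ler_pM ?exprn_ge0 // lerXn2r ?nnegrE // (le_trans yM1_le).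
  have ln : l.+1%:R != 0 :> R by rewrite pnatr_eq0.
  by rewrite exprSr -!mulrA mulKf // lexx.
have small : y l ^+ d.+2 / d.+2%:R <= y l ^+ d.+2 / d.+1%:R.
  by rewrite ler_wpM2l ?exprn_ge0 // lef_pV2 ?posrE ?ltr0n // ler_nat.
have yMd : 0 <= y M ^+ d.+2 / d.+2%:R by rewrite divr_ge0 ?exprn_ge0.
rewrite -(ler_pdivrMl _ _ p0) in step.
have pV0 : 0 <= d.+1%:R^-1 :> R by rewrite invr_ge0.
have {}top := ler_wpM2l pV0 top.
have pq : d.+1%:R^-1 * (d.+2%:R * y l ^+ d.+2) =
    y l ^+ d.+2 + d.+1%:R^-1 * y l ^+ d.+2.
  by rewrite -[d.+2%:R]natr1 mulrA mulrDr mulVf ?gt_eqF // mulr1 mulrDl mul1r.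
rewrite -/(y l) -/(y M); have yl0 : 0 <= y l ^+ d.+2 / d.+1%:R by rewrite divr_ge0 ?exprn_ge0.
move: top small step yMd pq yl0.
have ly : y l ^+ d.+2 = y l ^+ d.+1 * y l by rewrite exprSr.
rewrite ly; move: (y l) (y M) (y M ^+ _) (y l.+1 ^+ _) (y M.+1 ^+ _) (y l ^+ _).
by move: d.+2%:R l.+1%:R d.+1%:R^-1 d.+2%:R^-1 => *; lra.
Qed.

Lemma weight_ge0 (R : realFieldType) (d M j : nat) : 0 <= weight R d M j.
Proof. by rewrite /weight; case: ifP => // _; rewrite exprn_ge0 // invr_ge0. Qed.

Lemma tail_ge0 (R : realFieldType) (d M l : nat) : 0 <= tail R d M l.
Proof. by apply: sumr_ge0 => j _; rewrite mulr_ge0 // weight_ge0. Qed.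

Lemma sum_weight_sub (R : realFieldType) (d M l : nat) (g : nat -> R) :
  (l <= M)%N ->
  \sum_(l <= j < M.+1) (weight R d M j - weight R d M j.+1) * g j =
    weight R d M l * g l
      + \sum_(l <= j < M.+1) weight R d M j.+1 * (g j.+1 - g j).
Proof.
by move=> lM; rewrite sum_abel 1?leqW // {2}/weight ltnn mul0r subr0.
Qed.

(** At the top level the whole weight drops to zero, hence the indicator term. *)
Lemma weight_sub_le (R : realFieldType) (d M j : nat) : (j <= M)%N ->
  weight R d M j - weight R d M j.+1 <=
    d.+3%:R * j.+1%:R^-1 ^+ d.+4 + (j == M)%:R * j.+1%:R^-1 ^+ d.+3.
Proof.
move=> jM; rewrite /weight jM ltn_neqAle jM andbT.
have y0 : 0 <= j.+1%:R^-1 :> R by rewrite invr_ge0.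
case: eqP => _ /=; rewrite ?mul1r ?mul0r ?subr0 ?addr0.
  by rewrite lerDr mulr_ge0 ?exprn_ge0.
by have [_] := @invX_step R j d.+2.
Qed.

(** * Harmonic bounds for the LP sum and the integral sum *)

(** One factor [d.+3] comes from the drop of the weight, the other from 1 + 2/(d+1) = (d+3)/(d+1) in
    the inner sum. The powers of [j.+1] multiply to its inverse; the added 1 pays for the top
    level. *)
Lemma lp_sum_le (R : realFieldType) (d M : nat) (kappa : R) (B : nat -> R) :
  (forall j, 0 <= B j <= kappa * j.+1%:R ^+ (2 * d.+2)) ->
  \sum_(0 <= j < M.+1) (weight R d M j - weight R d M j.+1) *
    (B j * \sum_(j <= i < M.+1)
      (weight R d M i - weight R d M i.+1) * i.+1%:R ^+ 2) <=
  kappa * d.+3%:R ^+ 2 / d.+1%:R *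
    (\sum_(0 <= j < M.+1) j.+1%:R^-1 + 1).
Proof.
move=> B_bd.
have kappa0 : 0 <= kappa.
  by have /andP[a b] := B_bd 0; move: (le_trans a b); rewrite expr1n mulr1.
have p0 : 0 < d.+1%:R :> R by rewrite ltr0n.
have term j : (j <= M)%N ->
    (weight R d M j - weight R d M j.+1) *
    (B j * \sum_(j <= i < M.+1)
      (weight R d M i - weight R d M i.+1) * i.+1%:R ^+ 2) <=
    kappa * d.+3%:R / d.+1%:R * (d.+3%:R * j.+1%:R^-1 + (j == M)%:R).
  move=> jM; pose J : R := j.+1%:R; have J0 : 0 < J by rewrite ltr0n.
  have /andP[B0 B_le] := B_bd j.
  have W_le : \sum_(j <= i < M.+1)
      (weight R d M i - weight R d M i.+1) * i.+1%:R ^+ 2 <=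
      d.+3%:R / d.+1%:R * J^-1 ^+ d.+1.
    rewrite (sum_weight_sub d (fun i => i.+1%:R ^+ 2) jM).
    rewrite (eq_bigr (fun i => weight R d M i.+1 * (2 * i + 3)%:R)) => [|i _].
      apply: le_trans (lerD (lexx _) (tail_le R d jM)) _.
      rewrite /weight jM -/J 2!exprSr.
      have -> : d.+3%:R = d.+1%:R + 2 :> R by rewrite -[2]/(2%:R) -natrD addn2.
      move: (J) J0 d.+1%:R p0 (J^-1 ^+ _) => b b0 p p0 a.
      by rewrite le_eqVlt; apply/orP; left; apply/eqP; field; rewrite !gt_eqF.
    congr (_ * _); rewrite natrD natrM -[i.+2%:R]natr1 -[i.+1%:R]natr1; ring.
  have W0 : 0 <= \sum_(j <= i < M.+1)
      (weight R d M i - weight R d M i.+1) * i.+1%:R ^+ 2.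
    rewrite (sum_weight_sub d (fun i => i.+1%:R ^+ 2) jM).
    rewrite addr_ge0 ?mulr_ge0 ?weight_ge0 ?exprn_ge0 // sumr_ge0 // => i _.
    by rewrite mulr_ge0 ?weight_ge0 // subr_ge0 lerXn2r ?nnegrE // ler_nat.
  have BW := ler_pM B0 W0 B_le W_le.
  apply: le_trans (ler_wpM2r (mulr_ge0 B0 W0) (weight_sub_le R d jM)) _.
  have y0 : 0 <= J^-1 by rewrite invr_ge0 ltW.
  apply: le_trans (ler_wpM2l _ BW) _.
    by rewrite addr_ge0 // mulr_ge0 ?exprn_ge0.
  rewrite -/J le_eqVlt; apply/orP; left; apply/eqP.
  have yJ : J^-1 ^+ d.+3 * J ^+ (2 * d.+2) * J^-1 ^+ d.+1 = 1.
    have -> : (2 * d.+2 = d.+3 + d.+1)%N by rewrite mul2n -addnn -addSnnS.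
    by rewrite mulrAC -exprD -exprMn mulVf ?gt_eqF // expr1n.
  transitivity (J^-1 ^+ d.+3 * J ^+ (2 * d.+2) * J^-1 ^+ d.+1 *
      (kappa * d.+3%:R / d.+1%:R * (d.+3%:R * J^-1 + (j == M)%:R))).
    rewrite (exprSr _ d.+3); move: (J^-1) d.+1%:R^-1 (J^-1 ^+ d.+3) => a b e.
    by move: (J ^+ _) (a ^+ _) => g h; ring.
  by rewrite yJ mul1r.
apply: le_trans (ler_sum_nat (fun j jM => term j _)) _; first by lia.
rewrite -mulr_sumr big_split /= -mulr_sumr.
have -> : \sum_(0 <= j < M.+1) (j == M)%:R = 1 :> R.
  rewrite big_nat_recr //= eqxx big_nat_cond big1 ?add0r // => j /andP[/andP[_ jM] _].
  by rewrite ltn_eqF.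
have H0 : 0 <= \sum_(0 <= j < M.+1) j.+1%:R^-1 :> R.
  by apply: sumr_ge0 => j _; rewrite invr_ge0.
rewrite expr2 mulrA -!(mulrAC _ _ d.+1%:R^-1) -!mulrA; do 2?apply: ler_wpM2l => //.
by rewrite mulrA ler_wpM2r ?invr_ge0 // mulrDr lerD2l mulr1 ler1n.
Qed.

Lemma sum_inv_sqr_le (R : realFieldType) (n : nat) :
  \sum_(0 <= j < n.+1) j.+1%:R^-1 ^+ 2 <= 2 :> R.
Proof.
rewrite big_nat_recl // invr1 expr1n -[leRHS]/(1 + 1) lerD2l.
pose y j : R := j.+1%:R^-1.
apply: (@le_trans _ _ (\sum_(0 <= j < n) - (y j.+1 - y j))).
  apply: ler_sum_nat => j _; rewrite opprB.
  by have [] := @invX_step R j 0; rewrite mul1r !expr1.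
rewrite sumrN telescope_sumr // opprB /y invr1 gerBl.
by rewrite invr_ge0.
Qed.

(** With c = d+2, the relative error of level J is 3c/J + J/(M+1): c/J from the tail, 2c/J from [D].
    Multiplied by 1/J and summed, it is at most 6c + 1. *)
Lemma opt_sum_ge (R : realFieldType) (d M : nat) (kappa : R) (D : nat -> R) :
  0 <= kappa -> (forall l, 0 <= D l) ->
  (forall l, kappa * (2 * d.+2%:R) * l.+1%:R ^+ (2 * d + 3)
    * (1 - 2 * d.+2%:R / l.+1%:R) <= D l) ->
  kappa * (2 * d.+2%:R) ^+ 2 / d.+1%:R *
    (\sum_(0 <= j < M.+1) j.+1%:R^-1 - (6 * d.+2%:R + 1)) <=
  \sum_(0 <= l < M.+1) d.+2%:R * tail R d M l * (weight R d M l * D l).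
Proof.
move=> kappa0 D0 D_ge; set K := (_ / _).
have K0 : 0 <= K by rewrite divr_ge0 ?mulr_ge0 ?exprn_ge0 ?mulr_ge0.
have c0 : 0 <= d.+2%:R :> R by [].
have term l : (l <= M)%N ->
    K * (l.+1%:R^-1 - 3 * d.+2%:R * l.+1%:R^-1 ^+ 2 - M.+1%:R^-1) <=
    d.+2%:R * tail R d M l * (weight R d M l * D l).
  move=> lM; pose J : R := l.+1%:R; have J0 : 0 < J by rewrite ltr0n.
  have y0 : 0 <= J^-1 by rewrite invr_ge0 ltW.
  have wD_ge : J^-1 ^+ d.+3 * (kappa * (2 * d.+2%:R) * J ^+ (2 * d + 3)) *
      (1 - 2 * d.+2%:R / J) <= weight R d M l * D l.
    rewrite /weight lM -mulrA ler_wpM2l ?exprn_ge0 //; exact: D_ge.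
  have p0 : 0 <= 2 / d.+1%:R * J^-1 ^+ d.+1 by rewrite mulr_ge0 ?exprn_ge0 ?divr_ge0.
  have q0 : 0 <= J^-1 ^+ d.+3 * (kappa * (2 * d.+2%:R) * J ^+ (2 * d + 3)).
    by rewrite mulr_ge0 ?exprn_ge0 // mulr_ge0 ?exprn_ge0 ?(ltW J0) // !mulr_ge0.
  have x0 : 0 <= d.+2%:R / J + J / M.+1%:R by rewrite addr_ge0 ?divr_ge0 ?(ltW J0).
  have z0 : 0 <= 2 * d.+2%:R / J by rewrite !mulr_ge0.
  have := mulr_one_sub_ge (tail_ge0 R d M l) (mulr_ge0 (weight_ge0 R d M l) (D0 l))
    p0 q0 x0 z0 (tail_ge R d lM) wD_ge.
  rewrite -(mulrA d.+2%:R (tail _ _ _ _)); move/(ler_wpM2l c0); apply: le_trans.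
  rewrite le_eqVlt; apply/orP; left; apply/eqP.
  have yJ : J^-1 ^+ d.+1 * J^-1 ^+ d.+3 * J ^+ (2 * d + 3) = J^-1.
    have -> : (2 * d + 3 = d.+1 + d.+2)%N by rewrite mul2n -addnn addn3 addSn !addnS.
    rewrite -exprD addnS exprSr mulrAC -exprMn mulVf ?gt_eqF //.
    by rewrite expr1n mul1r.
  transitivity (K * (J^-1 ^+ d.+1 * J^-1 ^+ d.+3 * J ^+ (2 * d + 3)) *
     (1 - (d.+2%:R / J + J / M.+1%:R) - 2 * d.+2%:R / J)).
    rewrite yJ -/J; move: M.+1%:R^-1 => m.
    by move: (J) J0 (d.+2%:R) => b b0 p; field; rewrite gt_eqF.
  rewrite /K; move: (J ^+ (2 * d + 3)) (J^-1 ^+ d.+3) (J^-1 ^+ d.+1) => a b e.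
  move: (J) M.+1%:R^-1 d.+2%:R d.+1%:R^-1 J^-1 => f g h i j.
  by ring.
apply: le_trans (ler_sum_nat (fun l lM => term l _)); last by lia.
rewrite -mulr_sumr ler_wpM2l // !sumrB -mulr_sumr sumr_const_nat subn0.
rewrite -(mulr_natr _^-1 M.+1) mulVf ?pnatr_eq0 //.
have := ler_wpM2l c0 (sum_inv_sqr_le R M); lra.
Qed.

(** * Integral clique numbers and the resulting gap *)

(** Scaling by a power of [(M.+1)!] makes all weights integral, because [j.+1] divides this
    factorial. *)
Definition level_count (d M j : nat) : nat :=
  (if j <= M then ((M.+1)`! %/ j.+1) ^ d.+3 else 0)%N.

Lemma level_countE (R : realFieldType) (d M j : nat) :
  (level_count d M j)%:R = (M.+1)`!%:R ^+ d.+3 * weight R d M j.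
Proof.
rewrite /level_count /weight; case: ifP => jM; last by rewrite mulr0.
have dv : (j.+1 %| (M.+1)`!)%N by rewrite dvdn_fact.
rewrite natrX -exprMn; congr (_ ^+ _).
by rewrite -{2}(divnK dv) natrM mulfK // pnatr_eq0.
Qed.

Lemma level_count_antitone (d M j : nat) :
  (level_count d M j.+1 <= level_count d M j)%N.
Proof.
rewrite /level_count; case: ifP => // jM; rewrite (ltnW jM) leq_exp2r //.
exact: leq_div2l.
Qed.

Lemma mssc_gap_family (R : realFieldType) (d M : nat) :
  exists (n : nat) (E : {set {set 'I_n}}) (K : R),
    [/\ E != set0, uniform d.+2 E, 0 <= K,
      exists (x : 'I_n -> 'I_n -> R) (u : {set 'I_n} -> 'I_n -> R),
        lp_feasible E x u /\
        lp_obj E u <=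
          K * d.+3%:R ^+ 2 * (\sum_(0 <= j < M.+1) j.+1%:R^-1 + 1) &
      K * (2 * d.+2%:R) ^+ 2 *
        (\sum_(0 <= j < M.+1) j.+1%:R^-1 - (6 * d.+2%:R + 1)) <=
      (mssc_opt E)%:R].
Proof.
pose q j := (level_count d M j - level_count d M j.+1)%N.
pose Q : R := (M.+1)`!%:R ^+ d.+3.
have Q0 : 0 <= Q by rewrite exprn_ge0.
have qE j : (q j)%:R = Q * (weight R d M j - weight R d M j.+1).
  by rewrite natrB ?level_count_antitone // !level_countE -mulrBr.
have qM : (0 < q M.+1.-1)%N.
  rewrite /q /level_count leqnn ltnn subn0 expn_gt0 divn_gt0 //.
  by rewrite fact_geq.
have [n [E [E0 Eu [x [u [feas obj]]] opt]]] := clique_levels R d.+1 (ltn0Sn M) qM.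
pose kappa : R := d.+2%:R ^+ d.+1 / d.+1`!%:R.
have kappa0 : 0 <= kappa by rewrite divr_ge0 ?exprn_ge0.
(* Both costs are quadratic in the clique numbers, so the scaling [Q] enters squared and cancels in
   the ratio. *)
exists n, E, (Q ^+ 2 * (kappa / d.+1%:R)); split=> //.
- by rewrite mulr_ge0 ?exprn_ge0 // divr_ge0.
- exists x, u; split=> //; apply: le_trans obj _.
  have B_bd j : (0 : R) <= 'C(d.+2 * j.+1 ^ 2, d.+2)%:R
      <= kappa * j.+1%:R ^+ (2 * d.+2) by rewrite ler0n bin_square_le.
  have -> : (\sum_(0 <= j < M.+1) q j * ('C(d.+2 * j.+1 ^ 2, d.+2) *
        \sum_(j <= i < M.+1) q i * i.+1 ^ 2))%:R =
      Q ^+ 2 * \sum_(0 <= j < M.+1) (weight R d M j - weight R d M j.+1) *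
        ('C(d.+2 * j.+1 ^ 2, d.+2)%:R * \sum_(j <= i < M.+1)
          (weight R d M i - weight R d M i.+1) * i.+1%:R ^+ 2).
    rewrite natr_sum mulr_sumr; apply: eq_bigr => j _.
    rewrite !natrM natr_sum qE.
    under eq_bigr => i _ do rewrite natrM qE natrX -mulrA.
    by rewrite -mulr_sumr; ring.
  apply: le_trans (ler_wpM2l (exprn_ge0 2 Q0) (lp_sum_le M B_bd)) _.
  by rewrite le_eqVlt; apply/orP; left; apply/eqP; ring.
rewrite -(ler_nat R) in opt; apply: le_trans opt.
pose D l := ('C(d.+2 * l.+1 ^ 2, d.+2) - 'C(d.+2 * l ^ 2, d.+2))%N.
have -> : (\sum_(0 <= l < M.+1)
      (\sum_(l <= j < M.+1) q j * (d.+2 * (j.+1 ^ 2 - l.+1 ^ 2))) *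
      ((\sum_(l <= j < M.+1) q j) * D l))%:R =
    Q ^+ 2 * \sum_(0 <= l < M.+1)
      d.+2%:R * tail R d M l * (weight R d M l * (D l)%:R).
  rewrite natr_sum mulr_sumr; apply: eq_big_nat => l lM.
  have {}lM : (l <= M)%N by lia.
  rewrite !natrM !natr_sum.
  have -> : \sum_(l <= j < M.+1) (q j)%:R = Q * weight R d M l.
    have := sum_weight_sub d (fun _ => 1 : R) lM.
    rewrite [X in _ + X]big1 => [|j _]; last by rewrite subrr mulr0.
    rewrite addr0 mulr1 => <-; rewrite mulr_sumr; apply: eq_bigr => j _.
    by rewrite qE mulr1.
  have -> : \sum_(l <= j < M.+1) (q j * (d.+2 * (j.+1 ^ 2 - l.+1 ^ 2)))%:R =
      Q * (d.+2%:R * tail R d M l).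
    have := sum_weight_sub d (fun j => j.+1%:R ^+ 2 - l.+1%:R ^+ 2 : R) lM.
    rewrite subrr mulr0 add0r => tailE.
    have {}tailE : tail R d M l = \sum_(l <= j < M.+1)
        (weight R d M j - weight R d M j.+1) * (j.+1%:R ^+ 2 - l.+1%:R ^+ 2).
      rewrite tailE; apply: eq_bigr => j _; congr (_ * _).
      by rewrite natrD natrM -[j.+2%:R]natr1 -[j.+1%:R]natr1; ring.
    rewrite tailE !mulr_sumr; apply: eq_big_nat => j /andP[lj _].
    by rewrite 2!natrM qE natrB ?leq_exp2r // !natrX; ring.
  by ring.
have D_ge l : kappa * (2 * d.+2%:R) * l.+1%:R ^+ (2 * d + 3)
    * (1 - 2 * d.+2%:R / l.+1%:R) <= (D l)%:R by exact: bin_square_diff_ge.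
apply: le_trans (ler_wpM2l (exprn_ge0 2 Q0)
  (opt_sum_ge M kappa0 (fun l => ler0n _ (D l)) D_ge)).
by rewrite le_eqVlt; apply/orP; left; apply/eqP; ring.
Qed.

Theorem theorem4p3 (R : realType) (c : nat) (eps : R) :
  (2 <= c)%N -> 0 < eps ->
  exists (n : nat) (E : {set {set 'I_n}}),
    [/\ E != set0, uniform c E &
      exists (x : 'I_n -> 'I_n -> R) (u : {set 'I_n} -> 'I_n -> R),
        lp_feasible E x u /\
        ((((2 * c)%:R / (c + 1)%:R) ^+ 2 - eps) * lp_obj E u
           <= (mssc_opt E)%:R)].
Proof.
case: c => [|[|d]] // _ eps0.
pose C : R := d.+2%:R.
(* The additive losses 1 and 6C + 1 together cost (2C)^2 (6C + 2), which eps times the harmonic sum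
   must outweigh. *)
have [M H_ge] := harmonic_unbounded ((2 * C) ^+ 2 * (6 * C + 2) / eps).
have [n [E [K [E0 Eu K0 [x [u [feas obj]]] opt]]]] := mssc_gap_family R d M.
exists n, E; split=> //; exists x, u; split=> //.
have [_ u0 _ _ _] := feas.
have obj0 : 0 <= lp_obj E u.
  by apply: sumr_ge0 => t _; apply: sumr_ge0 => e eE; rewrite mulr_ge0 ?u0.
set G := (_ / _) ^+ 2.
(* The LP bound can be inserted only if the factor [G - eps] is nonnegative; otherwise the left side
   is nonpositive. *)
have [G_le|G_gt] := leP G eps.
  by apply: le_trans (ler0n _ _); rewrite mulr_le0_ge0 // subr_le0.
apply: le_trans opt.
have Geps0 : 0 <= G - eps by rewrite subr_ge0 ltW.
apply: le_trans (ler_wpM2l Geps0 obj) _.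
move: H_ge; set H := \sum_(0 <= _ < _) _ => H_ge.
have c3 : 0 < d.+3%:R :> R by rewrite ltr0n.
have GE : G * d.+3%:R ^+ 2 = (2 * C) ^+ 2.
  by rewrite /G expr_div_n addn1 divfK ?expf_neq0 ?gt_eqF // natrM.
have -> : (G - eps) * (K * d.+3%:R ^+ 2 * (H + 1)) =
    K * ((G * d.+3%:R ^+ 2 - eps * d.+3%:R ^+ 2) * (H + 1)).
  by move: (G) (H) d.+3%:R => g h p; ring.
rewrite GE -[leRHS]mulrA ler_wpM2l //.
rewrite ler_pdivrMr // in H_ge.
have c3_ge1 : 1 <= d.+3%:R ^+ 2 :> R by rewrite -natrX ler1n expn_gt0.
have C0 : 0 <= C by [].
have H0 : 0 <= H by apply: sumr_ge0 => j _; rewrite invr_ge0.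
have : eps * (H + 1) <= eps * d.+3%:R ^+ 2 * (H + 1).
  by rewrite ler_wpM2r ?addr_ge0 // ler_peMr // ltW.
move: H_ge eps0; move: ((2 * C) ^+ 2) (d.+3%:R ^+ 2) => a b; nra.
Qed.
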